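(* Let $k$ be a fixed positive integer. For each $n$ let $G=G(n)$ be a graph on $n$ vertices with maximum degree at most $\Delta=\Delta(n)$, and let $L$ be a random $(k,\mathcal{C})$-list assignment for $G$, where $|\mathcal{C}|=\sigma=\sigma(n)$. If $\sigma(n)=\omega\left(n^{1/k^2}\Delta^{1/k}\right)$ and $\Delta=O\left(n^{\frac{k-1}{k(k^3+2k^2-k+1)}}\right)$, then with high probability $G$ is $L$-colorable.
   Context: Graphs are finite and simple. A list assignment $L$ for a graph $G$ assigns to each vertex $v$ a set $L(v)$ of colors. $G$ is $L$-colorable if there is a proper vertex coloring $\varphi$ of $G$ with $\varphi(v)\in L(v)$ for every $v\in V(G)$ (such $\varphi$ is an $L$-coloring). A random $(k,\mathcal{C})$-list assignment for $G$, where $\mathcal{C}=\{1,2,\dots,\sigma\}$ (with $\sigma=\sigma(n)\ge k$), is obtained by choosing, for each vertex $v$, the list $L(v)$ independently and uniformly at random from all $k$-element subsets of $\mathcal{C}$. An event $A_n$ occurs with high probability if $\lim_{n\to\infty}\mathbb{P}[A_n]=1$. Asymptotic notation is with respect to $n\to\infty$. *)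

(* Defs.v *)
From HB Require Import structures.
From mathcomp Require Import all_boot all_order all_algebra.
From mathcomp Require Import all_classical all_reals all_analysis.

Set Implicit Arguments.
Unset Strict Implicit.
Unset Printing Implicit Defensive.

Import Order.TTheory GRing.Theory Num.Theory.

Local Open Scope ring_scope.

Record sgraph := SGraph {
  svertex :> finType;
  adj : rel svertex;
  adj_sym : symmetric adj;
  adj_irrefl : irreflexive adj
}.

Definition degree (G : sgraph) (v : G) : nat := #|[set w : G | adj v w]|.

Definition max_degree (G : sgraph) : nat := \max_(v : G) degree v.

Definition list_assignment (G : sgraph) (C : finType) := {ffun G -> {set C}}.

Definition proper_coloring (G : sgraph) (C : finType) (phi : {ffun G -> C}) : bool :=
  [forall v, forall w, adj v w ==> (phi v != phi w)].

Definition list_colorable (G : sgraph) (C : finType) (L : list_assignment G C) : bool :=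
  [exists phi : {ffun G -> C},
     proper_coloring phi && [forall v, phi v \in L v]].

Definition uniform_ksubset (R : realType) (k : nat) (C : finType) (S : {set C}) : R :=
  if #|S| == k then ('C(#|C|, k)%:R)^-1 else 0.

(* The weight of [L] is a product over the vertices because the lists are
   chosen independently; the weights sum to 1 as soon as [k <= #|C|]. *)
Definition random_list_prob (R : realType) (k : nat) (G : sgraph) (C : finType)
    (A : pred (list_assignment G C)) : R :=
  \sum_(L : list_assignment G C | A L) \prod_(v : G) uniform_ksubset R k (L v).

(* Main.v *)
Require Import Defs.
From HB Require Import structures.
From mathcomp Require Import all_boot all_order all_algebra.
From mathcomp Require Import all_classical all_reals all_analysis.
From mathcomp Require Import zify ring lra.
Import Order.TTheory GRing.Theory Num.Theory.
Import numFieldNormedType.Exports.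

(** If [G] is not [L]-colorable, take a minimal vertex set [H] on which the
    coloring fails.  Two properties of [H] make it unlikely.

    Its lists use few colors: [#|pot L H| < #|H|] ([critical_small_pot]).
    Otherwise Hall's theorem colors all of [H] outside some proper subset [X]
    injectively and with colors that no list on [X] contains, and a coloring
    of [X], which exists by minimality, completes it.

    It is connected through edges whose ends have intersecting lists
    ([critical_edge]), since otherwise colorings of two parts could be glued.
    So [H] can be explored one vertex at a time, each new vertex being a
    neighbor of an earlier one and bringing at most [k - 1] new colors: the
    first [m] vertices see at most [(k - 1) m + 1] colors
    ([critical_growth]).

    There are at most [n (m Delta)^(m - 1)] explorations of length [m]
    ([size_growths]), and [m] given lists of size [k] have at most [q] colors
    in total with probability at most [q^(k m) / sigma^(k m - q)]
    ([random_list_prob_crowded]).  The union bound runs over explorations of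
    bounded length only.  Put [D := k^3 + 2 k^2 - k + 1] and [t := k^2 D].

    If [#|H| > t], explore [t + 1] vertices with [q = (k - 1)(t + 1) + 1];
    the expected number of such explorations is [O(n (Delta / sigma)^t)].
    From [Delta^(k D) = O(n^(k - 1))] and [n Delta^k = o(sigma^(k^2))] this
    tends to [0] ([long_growth_estimate]).

    If [#|H| = m <= t], explore all of [H] with [q = m - 1].  A list has [k]
    colors, so [m - 1 >= k], and the expected number is at most a constant times
    [n Delta^(m - 1) / sigma^(k m - m + 1)], which equals
    [(n Delta^k / sigma^(k^2)) (Delta / sigma^(k - 1))^(m - 1 - k)].  The
    first factor tends to [0], the second is bounded ([density_bounded]).

    The asymptotic hypotheses enter only through integer powers, so that
    [prob_uncolorable_le] is a statement about a single graph. *)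

(** * Hall's theorem and small color sets *)

Definition pot {T C : finType} (F : T -> {set C}) (X : {set T}) : {set C} :=
  (\bigcup_(v in X) F v)%SET.

Lemma potU {T C : finType} (F : T -> {set C}) (X Y : {set T}) :
  pot F (X :|: Y) = pot F X :|: pot F Y.
Proof. exact: finset.bigcup_setU. Qed.

Lemma pot1 {T C : finType} (F : T -> {set C}) (v : T) : pot F [set v] = F v.
Proof. exact: big_set1. Qed.

Lemma sub_pot {T C : finType} (F : T -> {set C}) (X : {set T}) (v : T) :
  v \in X -> F v \subset pot F X.
Proof. exact: (@finset.bigcup_sup _ _ v (mem X)). Qed.

Lemma potD {T C : finType} (F : T -> {set C}) (S : {set C}) (X : {set T}) :
  pot (fun v => F v :\: S) X = pot F X :\: S.
Proof.
apply/setP=> c; rewrite !inE; apply/finset.bigcupP/andP.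
  case=> v vX; rewrite inE => /andP[cS cv]; split=> //.
  by apply/finset.bigcupP; exists v.
by case=> cS /finset.bigcupP[v vX cv]; exists v => //; rewrite inE cS.
Qed.

(** Removing the colors of [Y] from every list keeps Hall-type counts
    computable: this is how Hall's condition is checked on the vertices
    outside [Y] once the colors of [Y] are reserved. *)
Lemma card_pot_setD {T C : finType} (F : T -> {set C}) (Y Z : {set T}) :
  #|pot (fun v => F v :\: pot F Y) Z| = #|pot F (Y :|: Z)| - #|pot F Y|.
Proof.
rewrite potD potU -cardsDS ?finset.subsetUl //; apply: eq_card => c.
by rewrite !inE; case: (c \in pot F Y).
Qed.

(** Halmos and Vaughan's induction: if some proper nonempty [Y] is tight, the
    condition passes to [Y] and, once the colors of [Y] are removed, to its
    complement; if none is, any vertex may take any of its colors, as losing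
    one color leaves the condition true for the other vertices. *)
Lemma hall {T C : finType} (c0 : C) (F : T -> {set C}) (X : {set T}) :
  (forall Y : {set T}, Y \subset X -> #|Y| <= #|pot F Y|) ->
  exists f : T -> C,
    {in X, forall v, f v \in F v} /\ {in X &, injective f}.
Proof.
have [n] := ubnP #|X|; elim: n F X => // n IHn F X ltXn hallX.
have [X0|[x xX]] := set_0Vmem X.
  by exists (fun=> c0); rewrite X0; split=> v; rewrite inE.
case: (boolP [exists Y : {set T},
                [&& Y \proper X, Y != finset.set0 & #|pot F Y| <= #|Y|]]).
  case/existsP=> Y /and3P[YX Y0 leY].
  have YsX := proper_sub YX.
  have [||f [fF finj]] := IHn F Y.
  - by apply: leq_trans (proper_card YX) _; rewrite -ltnS.
  - by move=> Z ZY; apply: hallX; exact: fintype.subset_trans ZY YsX.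
  have [||g [gF ginj]] := IHn (fun v => F v :\: pot F Y) (X :\: Y).
  - have : 0 < #|Y| by rewrite card_gt0.
    have := subset_leq_card YsX; rewrite cardsDS //; lia.
  - move=> Z; rewrite finset.subsetD => /andP[ZX dZY].
    have := hallX (Y :|: Z); rewrite finset.subUset ZX YsX => /(_ isT).
    rewrite card_pot_setD cardsU disjoint_setI0 1?disjoint_sym // cards0; lia.
  exists (fun v => if v \in Y then f v else g v); split=> [v vX|v w vX wX].
    case: ifPn => vY; first exact: fF.
    by have := gF v; rewrite !inE vY vX => /(_ isT) /andP[].
  have gN u : u \in X -> u \notin Y -> g u \notin pot F Y.
    by move=> uX uY; have := gF u; rewrite !inE uY uX => /(_ isT) /andP[].
  have fY u : u \in Y -> f u \in pot F Y.
    by move=> uY; apply: (fintype.subsetP (sub_pot F Y u uY)) (fF u uY).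
  case: ifPn => vY; case: ifPn => wY.
  - exact: finj.
  - by move=> fg; have := gN w wX wY; rewrite -fg fY.
  - by move=> fg; have := gN v vX vY; rewrite fg fY.
  - by apply: ginj; rewrite !inE ?vY ?wY.
move=> /existsPn noTight.
have [c cx] : exists c, c \in F x.
  apply/set0Pn; rewrite -card_gt0 -(pot1 F x) -(cards1 x).
  by apply: hallX; rewrite finset.sub1set.
have [||f [fF finj]] := IHn (fun v => F v :\ c) (X :\ x).
- by move: ltXn; rewrite (cardsD1 x X) xX.
- move=> Z ZX; rewrite potD; have [->|Z0] := eqVneq Z finset.set0.
    by rewrite cards0.
  have := noTight Z; rewrite Z0 (sub_proper_trans ZX (properD1 xX)) /= -ltnNge.
  by rewrite (cardsD1 c (pot F Z)); case: (c \in _);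
    rewrite ?add0n ?add1n ?ltnS //; exact: ltnW.
exists (fun v => if v == x then c else f v); split=> [v vX|v w vX wX].
  case: eqVneq => [->//|vx].
  by have := fF v; rewrite !inE vx vX => /(_ isT) /andP[].
have fN u : u \in X -> u != x -> f u != c.
  by move=> uX ux; have := fF u; rewrite !inE ux uX => /(_ isT) /andP[].
case: eqVneq => [->|vx]; case: eqVneq => [->|wx] //.
- by move=> fg; have := fN w wX wx; rewrite -fg eqxx.
- by move=> fg; have := fN v vX vx; rewrite fg eqxx.
- by apply: finj; rewrite !inE ?vx ?wx.
Qed.

(** For [X] maximal among the sets violating Hall's condition (or empty), the
    condition holds outside [X] even after removing all colors of [X], because
    a violation there would enlarge [X]; and [X] is not [V] since [V] itself
    satisfies the condition. *)
Lemma hall_remainder {T C : finType} (c0 : C) (F : T -> {set C}) (V : {set T}) :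
  V != finset.set0 -> #|V| <= #|pot F V| ->
  exists (X : {set T}) (f : T -> C),
    [/\ X \proper V,
        {in V :\: X, forall v, f v \in F v :\: pot F X} &
        {in V :\: X &, injective f}].
Proof.
move=> V0 leV.
(* The empty set is admitted so that a maximal set always exists. *)
pose P := fun Y : {set T} =>
  (Y \subset V) && ((#|pot F Y| < #|Y|) || (Y == finset.set0)).
have [|X /maxsetP[/andP[XV defX] maxX] _] := @maxset_exists _ P finset.set0.
  by rewrite /P finset.sub0set eqxx orbT.
have leX : #|pot F X| <= #|X|.
  case/orP: defX => [/ltnW//|/eqP->].
  by rewrite /pot finset.big_set0 cards0.
have XpV : X \proper V.
  rewrite finset.properEneq XV andbT; apply: contraNneq V0 => XV'.
  by move: defX; rewrite XV' ltnNge leV.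
have [|f [fF finj]] := hall c0 (fun v => F v :\: pot F X) (V :\: X).
  move=> Z; rewrite finset.subsetD card_pot_setD => /andP[ZV dZX].
  have [->|Z0] := eqVneq Z finset.set0; first by rewrite cards0.
  have cU : #|X :|: Z| = #|X| + #|Z|.
    by rewrite cardsU disjoint_setI0 1?disjoint_sym // cards0 subn0.
  suff: #|X :|: Z| <= #|pot F (X :|: Z)| by rewrite cU; lia.
  rewrite leqNgt; apply: contra Z0 => lt; rewrite -cards_eq0.
  have := maxX (X :|: Z); rewrite /P finset.subUset XV ZV lt finset.subsetUl.
  by move=> /(_ isT isT) eqX; rewrite -(eqn_add2l #|X|) -cU eqX addn0.
by exists X, f.
Qed.

(** * Critical vertex sets *)

Definition colorable_on {G : sgraph} {C : finType} (L : list_assignment G C)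
    (X : {set G}) : bool :=
  `[< exists phi : G -> C, {in X, forall v, phi v \in L v} /\
        {in X &, forall v w, adj v w -> phi v != phi w} >].

Definition list_critical {G : sgraph} {C : finType} (L : list_assignment G C)
    (H : {set G}) : Prop :=
  ~~ colorable_on L H /\ forall X : {set G}, X \proper H -> colorable_on L X.

Lemma colorable_on_setT {G : sgraph} {C : finType} (L : list_assignment G C) :
  colorable_on L [set: G] -> list_colorable L.
Proof.
move=> /asboolP[phi [phiL phi_proper]]; apply/existsP.
exists [ffun v => phi v]; apply/andP; split.
  apply/forallP=> v; apply/forallP=> w; apply/implyP=> vw.
  by rewrite !ffunE phi_proper ?inE.
by apply/forallP=> v; rewrite ffunE phiL ?inE.
Qed.

Lemma colorable_on_set0 {G : sgraph} {C : finType} (c0 : C)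
    (L : list_assignment G C) : colorable_on L finset.set0.
Proof. by apply/asboolP; exists (fun=> c0); split=> v; rewrite inE. Qed.

Lemma ex_list_critical {G : sgraph} {C : finType} (L : list_assignment G C) :
  ~~ list_colorable L -> exists H : {set G}, list_critical L H.
Proof.
move=> nL; have nT : ~~ colorable_on L [set: G].
  by apply: contra nL; exact: colorable_on_setT.
have [H /minsetP[nH minH] _] :=
  @minset_exists _ (fun X => ~~ colorable_on L X) _ nT.
exists H; split=> // X XH; apply: contraTT XH => nX; rewrite properE.
apply/negP=> /andP[XH]; have -> := minH X nX XH.
by rewrite fintype.subxx.
Qed.

Lemma critical_neq0 {G : sgraph} {C : finType} (c0 : C)
    (L : list_assignment G C) (H : {set G}) :
  list_critical L H -> H != finset.set0.
Proof.
by case=> nH _; apply: contraNneq nH => ->; exact: colorable_on_set0.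
Qed.

(** Kierstead's small pot lemma. *)
Lemma critical_small_pot {G : sgraph} {C : finType} (c0 : C)
    (L : list_assignment G C) (H : {set G}) :
  list_critical L H -> #|pot L H| < #|H|.
Proof.
move=> critH; have H0 := critical_neq0 c0 L H critH; case: critH => nH subH.
rewrite ltnNge; apply: contra nH => leH.
have [X [f [XH fL finj]]] := hall_remainder c0 L H H0 leH.
have /asboolP[g [gL gP]] := subH X XH.
apply/asboolP; exists (fun v => if v \in X then g v else f v).
have gpot u : u \in X -> g u \in pot L X.
  by move=> uX; exact: (fintype.subsetP (sub_pot L X u uX)) (gL u uX).
have fpot u : u \in H -> u \notin X -> f u \notin pot L X.
  by move=> uH uX; have := fL u; rewrite !inE uX uH => /(_ isT) /andP[].
split=> [v vH|v w vH wH vw].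
  case: ifPn => vX; first exact: gL.
  by have := fL v; rewrite !inE vX vH => /(_ isT) /andP[].
case: ifPn => vX; case: ifPn => wX.
- exact: gP.
- by apply: contraNneq (fpot w wH wX) => <-; exact: gpot.
- by apply: contraNneq (fpot v vH vX) => ->; exact: gpot.
- apply: contraTneq vw => fvw.
  have -> : v = w by apply: finj; rewrite // !inE ?vX ?wX.
  by rewrite adj_irrefl.
Qed.

(** Edges between vertices with disjoint lists impose nothing, so [H] must be
    connected by the other ones: otherwise colorings of [X] and of [H :\: X]
    together would color [H]. *)
Lemma critical_edge {G : sgraph} {C : finType} (L : list_assignment G C)
    (H X : {set G}) :
  list_critical L H -> X \proper H -> X != finset.set0 ->
  exists v w, [/\ v \in X, w \in H :\: X, adj v w & ~~ [disjoint L v & L w]].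
Proof.
move=> [nH subH] XH X0; have XsH := proper_sub XH.
case: (boolP [exists v in X, [exists w in H :\: X,
                adj v w && ~~ [disjoint L v & L w]]]) => [|noEdge].
  case/exists_inP=> v vX /exists_inP[w wY /andP[vw dvw]].
  by exists v, w.
have cross v w : v \in X -> w \in H -> w \notin X -> adj v w ->
    [disjoint L v & L w].
  move=> vX wH wX vw; apply: contraR noEdge => dvw.
  apply/exists_inP; exists v => //; apply/exists_inP; exists w.
    by rewrite !inE wX.
  by rewrite vw.
have /asboolP[f [fL fP]] := subH X XH.
have /asboolP[g [gL gP]] : colorable_on L (H :\: X).
  apply: subH; rewrite finset.properEneq finset.subsetDl andbT.
  have /finset.set0Pn[x xX] := X0.
  apply/negP=> /eqP eqH; have : x \in H :\: X.
    by rewrite eqH; exact: (fintype.subsetP XsH).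
  by rewrite inE xX.
exfalso; move: nH; apply/negP/negPn.
apply/asboolP; exists (fun v => if v \in X then f v else g v).
have gY u : u \in H -> u \notin X -> g u \in L u.
  by move=> uH uX; apply: gL; rewrite inE uX.
split=> [v vH|v w vH wH vw]; first by case: ifPn => vX; [exact: fL|exact: gY].
case: ifPn => vX; case: ifPn => wX.
- exact: fP.
- have dvw := cross v w vX wH wX vw.
  apply: contraTneq (gY w wH wX) => <-.
  by rewrite (disjointFr dvw) // fL.
- have dwv : [disjoint L w & L v] by apply: cross; rewrite // adj_sym.
  apply: contraTneq (gY v vH vX) => ->.
  by rewrite (disjointFr dwv) // fL.
- by apply: gP; rewrite ?inE ?vX ?wX.
Qed.

(** * Explorations of a graph *)

(** The newest vertex is at the head of the list.  Repetitions of vertices are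
    allowed, and neighbors common to several vertices are listed several times;
    this only makes the union bound coarser. *)
Definition extensions {G : sgraph} (s : seq G) : seq G :=
  if s is [::] then enum G
  else flatten [seq enum [set w : G | adj v w] | v <- s].

Fixpoint growths (G : sgraph) (m : nat) : seq (seq G) :=
  if m is m'.+1 then [seq w :: s | s <- growths G m', w <- extensions s]
  else [:: [::]].

Lemma size_growth (G : sgraph) (m : nat) (s : seq G) :
  s \in growths G m -> size s = m.
Proof.
elim: m s => [|m IHm] s /=; first by rewrite inE => /eqP->.
by case/allpairsPdep=> t [w [tm _ ->]] /=; rewrite IHm.
Qed.

Lemma size_extensions {G : sgraph} (s : seq G) :
  s != [::] -> size (extensions s) <= size s * max_degree G.
Proof.
case: s => // v0 s _; rewrite /extensions; elim: (v0 :: s) => //= v t IHt.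
rewrite size_cat mulSn leq_add // -cardE.
exact: (@leq_bigmax _ (fun u : G => degree u) v).
Qed.

Lemma size_growths (G : sgraph) (m : nat) :
  size (growths G m.+1) <= #|G| * (m * max_degree G) ^ m.
Proof.
elim: m => [|m IHm].
  by rewrite /= cats0 size_map -cardE muln1.
have step : size (growths G m.+2) <= size (growths G m.+1) * (m.+1 * max_degree G).
  rewrite [growths G m.+2]/= -/(growths G m.+1) size_allpairs_dep.
  have := @size_growth G m.+1; elim: (growths G m.+1) => //= s t IHt sizeP.
  rewrite mulSn leq_add //; last first.
    by apply: IHt => u ut; apply: sizeP; rewrite inE ut orbT.
  have ss : size s = m.+1 by apply: sizeP; rewrite inE eqxx.
  by rewrite -ss size_extensions // -size_eq0 ss.
apply: leq_trans step _; rewrite expnSr [leqRHS]mulnA leq_mul //.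
apply: leq_trans IHm _; rewrite leq_mul //.
by case: (m) => // m'; rewrite leq_exp2r // leq_mul.
Qed.

(** After the first vertex, with [k] colors, each new vertex is chosen across
    an edge with intersecting lists and so adds at most [k - 1] colors. *)
Lemma critical_growth {G : sgraph} {C : finType} (c0 : C)
    (L : list_assignment G C) (H : {set G}) (k m : nat) :
  0 < k -> (forall v, #|L v| = k) -> list_critical L H -> m < #|H| ->
  exists s : seq G, [/\ s \in growths G m.+1, uniq s, [set v in s] \subset H &
    #|pot L [set v in s]| <= (k.-1 * m.+1).+1].
Proof.
move=> k0 Lk critH; elim: m => [|m IHm] ltm.
  have /finset.set0Pn[v vH] := critical_neq0 c0 L H critH.
  exists [:: v]; split=> //.
  - by rewrite /= cats0; apply: map_f; rewrite mem_enum.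
  - by apply/fintype.subsetP=> w; rewrite !inE => /eqP->.
  - have -> : [set w in [:: v]] = [set v] by apply/setP=> w; rewrite !inE.
    by rewrite pot1 Lk muln1 prednK.
have [s [sG us sH ps]] := IHm (ltnW ltm).
have ss := size_growth _ _ _ sG.
have cs : #|[set v in s]| = m.+1 by rewrite cardsE -ss; exact/card_uniqP.
have [||v [w [vs]]] := critical_edge L H [set v in s] critH.
- by rewrite finset.properEcard sH cs.
- by rewrite -card_gt0 cs.
rewrite !inE => /andP[ws wH] vw dvw.
exists (w :: s); split.
- apply/allpairsPdep; exists s, w; split=> //.
  rewrite /extensions; case: s ss vs {sG us sH ps cs ws} => // u s _ vs.
  apply/flattenP; exists (enum [set x | adj v x]); last by rewrite mem_enum inE.
  by apply/mapP; exists v => //; rewrite inE in vs.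
- by rewrite /= ws.
- apply/fintype.subsetP=> x; rewrite !inE => /orP[/eqP->//|xs].
  by apply: (fintype.subsetP sH); rewrite inE.
have -> : [set x in w :: s] = [set w] :|: [set x in s].
  by apply/setP=> x; rewrite !inE.
rewrite potU pot1 cardsU Lk.
have : 0 < #|L w :&: pot L [set x in s]|.
  rewrite card_gt0; apply: contra dvw; rewrite finset.setI_eq0 => dws.
  rewrite disjoint_sym; apply: disjointWr dws.
  exact: (sub_pot L [set x in s] v vs).
by move: ps; rewrite !mulnS; lia.
Qed.

(** Distinctness of the vertices is part of the event: explorations may repeat
    a vertex, and repeated vertices do not carry independent lists. *)
Definition crowded {G : sgraph} {C : finType} (q : nat) (s : seq G)
    (L : list_assignment G C) : bool :=
  uniq s && (#|pot L [set v in s]| <= q).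

(** [M] is the length at which the exploration of a large critical set stops.
    A critical set with fewer than [M] vertices is explored completely, and it
    has more than [k] vertices because it has more vertices than colors. *)
Lemma uncolorable_crowded {G : sgraph} {C : finType} (c0 : C)
    (L : list_assignment G C) (k M : nat) :
  0 < k -> 0 < M -> (forall v, #|L v| = k) -> ~~ list_colorable L ->
  has (fun s => crowded (k.-1 * M).+1 s L) (growths G M) ||
  has (fun m => has (fun s => crowded m.-1 s L) (growths G m))
      (index_iota k.+1 M).
Proof.
move=> k0 M0 Lk /ex_list_critical[H critH]; apply/orP.
have [leM|ltM] := leqP M #|H|.
  left; apply/hasP.
  have [|s [sG us _ ps]] := critical_growth c0 L H k M.-1 k0 Lk critH.
    by rewrite prednK.
  by rewrite prednK // in sG ps; exists s; rewrite // /crowded us.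
have sp := critical_small_pot c0 L H critH.
have /finset.set0Pn[v vH] := critical_neq0 c0 L H critH.
have ltk : k < #|H|.
  by apply: leq_ltn_trans sp; rewrite -(Lk v); exact/subset_leq_card/sub_pot.
right; apply/hasP; exists #|H|; first by rewrite mem_index_iota ltk.
have H0 : 0 < #|H| by apply: leq_ltn_trans ltk.
have [|s [sG us sH _]] := critical_growth c0 L H k #|H|.-1 k0 Lk critH.
  by rewrite prednK.
rewrite prednK // in sG; apply/hasP; exists s; rewrite // /crowded us /=.
have cs : #|[set v in s]| = #|H|.
  by rewrite cardsE -[RHS](size_growth _ _ _ sG); exact/card_uniqP.
have -> : [set v in s] = H.
  by apply/eqP; rewrite eqEcard sH cs leqnn.
by rewrite -ltnS prednK.
Qed.

Local Open Scope ring_scope.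

(** * Random lists *)

Lemma uniform_ksubset_ge0 (R : realType) (k : nat) {C : finType} (S : {set C}) :
  0 <= uniform_ksubset R k S.
Proof. by rewrite /uniform_ksubset; case: ifP => // _; rewrite invr_ge0. Qed.

Lemma sum_uniform_ksubset (R : realType) (k : nat) {C : finType} (S : {set C}) :
  \sum_(T : {set C} | T \subset S) uniform_ksubset R k T
    = 'C(#|S|, k)%:R / 'C(#|C|, k)%:R.
Proof.
rewrite /uniform_ksubset -big_mkcondr sumr_const -cards_draws mulr_natl.
by congr (_ *+ _); apply: eq_card => T; rewrite !inE.
Qed.

(** Independence: expanding the product over the vertices of the probabilities
    that each single list lies in [S] gives the sum over all assignments. *)
Lemma random_list_prob_sub (R : realType) (k : nat) {G : sgraph} {C : finType}
    (X : {set G}) (S : {set C}) : (k <= #|C|)%N ->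
  random_list_prob R k
    (fun L : list_assignment G C => [forall v in X, L v \subset S])
    = ('C(#|S|, k)%:R / 'C(#|C|, k)%:R) ^+ #|X|.
Proof.
move=> kC; rewrite /random_list_prob.
pose Q (v : G) (T : {set C}) := (v \in X) ==> (T \subset S).
transitivity (\sum_(L in family Q) \prod_(v : G) uniform_ksubset R k (L v)).
  by apply: eq_bigl => L; apply/forallP/familyP.
rewrite -(@bigA_distr_big_dep _ _ _ _ _ _ _ Q (fun _ T => uniform_ksubset R k T))
  -prodr_const [RHS]big_mkcond.
apply: eq_bigr => v _; rewrite /Q; case: ifP => vX /=.
  exact: sum_uniform_ksubset.
have := sum_uniform_ksubset R k [set: C]; rewrite cardsT divff; last first.
  by rewrite pnatr_eq0 -lt0n bin_gt0.
by move=> <-; apply: eq_bigl => T; rewrite finset.subsetT.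
Qed.

Lemma random_list_prob_total (R : realType) (k : nat) {G : sgraph} {C : finType} :
  (k <= #|C|)%N -> random_list_prob R k (fun _ : list_assignment G C => true) = 1.
Proof.
move=> kC; have := random_list_prob_sub R k (finset.set0 : {set G}) [set: C] kC.
rewrite cards0 expr0 => <-; apply: eq_bigl => L.
by apply/esym/forall_inP=> v; rewrite inE.
Qed.

Lemma random_list_prob_compl (R : realType) (k : nat) {G : sgraph} {C : finType}
    (A : pred (list_assignment G C)) : (k <= #|C|)%N ->
  1 - random_list_prob R k A = random_list_prob R k (fun L => ~~ A L).
Proof.
move=> kC; rewrite -(@random_list_prob_total R k G C kC).
by rewrite /random_list_prob (bigID A) /= addrAC subrr add0r.
Qed.

Lemma weight_ge0 (R : realType) (k : nat) {G : sgraph} {C : finType}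
    (L : list_assignment G C) : 0 <= \prod_(v : G) uniform_ksubset R k (L v).
Proof. by apply: prodr_ge0 => v _; exact: uniform_ksubset_ge0. Qed.

Lemma random_list_prob_ge0 (R : realType) (k : nat) {G : sgraph} {C : finType}
    (A : pred (list_assignment G C)) : 0 <= random_list_prob R k A.
Proof. by apply: sumr_ge0 => L _; exact: weight_ge0. Qed.

(** Only assignments of lists of size [k] have nonzero weight, so events need
    to be compared on these only. *)
Lemma random_list_prob_le (R : realType) (k : nat) {G : sgraph} {C : finType}
    (A B : pred (list_assignment G C)) :
  (forall L : list_assignment G C, (forall v, #|L v| = k) -> A L -> B L) ->
  random_list_prob R k A <= random_list_prob R k B.
Proof.
move=> AB; rewrite /random_list_prob big_mkcond [leRHS]big_mkcond.
apply: ler_sum => L _; case: ifP => AL; last first.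
  by case: ifP => // _; exact: weight_ge0.
case: (boolP [forall v, #|L v| == k]) => [/forallP Lk|].
  by rewrite AB // => v; exact/eqP.
rewrite negb_forall => /existsP[v Lv].
have -> : \prod_(v : G) uniform_ksubset R k (L v) = 0.
  by rewrite (bigD1 v) //= /uniform_ksubset (negPf Lv) mul0r.
by case: ifP.
Qed.

Lemma random_list_probU (R : realType) (k : nat) {G : sgraph} {C : finType}
    (A B : pred (list_assignment G C)) :
  random_list_prob R k (fun L => A L || B L)
    <= random_list_prob R k A + random_list_prob R k B.
Proof.
rewrite /random_list_prob big_mkcond [X in _ <= X + _]big_mkcond.
rewrite [X in _ <= _ + X]big_mkcond -big_split.
apply: ler_sum => L _ /=; have := weight_ge0 R k L.
by case: (A L); case: (B L) => /= w0; lra.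
Qed.

Lemma random_list_prob_has (R : realType) (k : nat) {G : sgraph} {C : finType}
    {I : Type} (r : seq I) (A : I -> pred (list_assignment G C)) :
  random_list_prob R k (fun L => has (fun i => A i L) r)
    <= \sum_(i <- r) random_list_prob R k (A i).
Proof.
elim: r => [|i r IHr]; first by rewrite big_nil /random_list_prob big_pred0.
rewrite big_cons; apply: le_trans (random_list_probU R k (A i) _) _.
by rewrite lerD2l.
Qed.

Lemma leq_bin_exp (k q p : nat) :
  (q <= p -> 'C(q, k) * p ^ k <= 'C(p, k) * q ^ k)%N.
Proof.
move=> qp; rewrite -(@leq_pmul2r k`!) ?fact_gt0 // mulnAC bin_ffact.
rewrite mulnAC bin_ffact; elim: k => // k IHk.
rewrite !ffactnSr !expnSr mulnACA [leqRHS]mulnACA leq_mul //.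
by rewrite !mulnBl [(p * q)%N]mulnC leq_sub2l // leq_mul2l qp orbT.
Qed.

Lemma ex_superset_card {C : finType} (A : {set C}) (q : nat) :
  (#|A| <= q <= #|C|)%N -> exists2 S : {set C}, A \subset S & #|S| = q.
Proof.
move=> /andP[]; elim: q => [|q IHq].
  by rewrite leqn0 cards_eq0 => /eqP-> _; exists finset.set0; rewrite ?cards0.
rewrite leq_eqVlt => /orP[/eqP<- _|]; first by exists A.
rewrite ltnS => Aq qC; have [S AS Sq] := IHq Aq (ltnW qC).
have /card_gt0P[c] : (0 < #|~: S|)%N by rewrite cardsCs finset.setCK Sq subn_gt0.
rewrite inE => cS; exists (c |: S); last by rewrite cardsU1 cS Sq.
exact: fintype.subset_trans AS (finset.subsetUr _ _).
Qed.

Lemma leq_bin_expn (n m : nat) : ('C(n, m) <= n ^ m)%N.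
Proof.
apply: (@leq_trans (n ^_ m)); first by rewrite -bin_ffact leq_pmulr ?fact_gt0.
by elim: m => // m IHm; rewrite ffactnSr expnSr leq_mul ?leq_subr.
Qed.

(** The lists lie together in one of the [q]-subsets [S] of [C]; there are at
    most [#|C|^q] of these, and a list lies in a given one with probability at
    most [(q / #|C|)^k].  When no [S] exists, that is for [q > #|C|], the bound
    exceeds [1]. *)
Lemma random_list_prob_crowded (R : realType) (k : nat) {G : sgraph} {C : finType}
    (q : nat) (s : seq G) : (k <= #|C|)%N -> (0 < #|C|)%N -> (q <= k * size s)%N ->
  random_list_prob R k (fun L : list_assignment G C => crowded q s L)
    <= q%:R ^+ (k * size s) / #|C|%:R ^+ (k * size s - q).
Proof.
move=> kC C0 qs; have C0R : 0 < #|C|%:R :> R by rewrite ltr0n.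
have [us|nus] := boolP (uniq s); last first.
  rewrite /random_list_prob big_pred0 => [|L]; last by rewrite /crowded (negPf nus).
  by rewrite divr_ge0 // exprn_ge0.
have cs : #|[set v in s]| = size s by rewrite cardsE; exact/card_uniqP.
have [qC|Cq] := leqP q #|C|; last first.
  apply: (@le_trans _ _ 1).
    rewrite -(@random_list_prob_total R k G C kC); exact: random_list_prob_le.
  rewrite ler_pdivlMr ?exprn_gt0 // mul1r -!natrX ler_nat.
  apply: leq_trans (leq_pexp2l _ (leq_subr q _)); last by apply: leq_ltn_trans Cq.
  by case: (k * size s - q)%N => // e; rewrite leq_exp2r // ltnW.
pose Ss := enum [set S : {set C} | #|S| == q].
pose inside (S : {set C}) (L : list_assignment G C) :=
  [forall v in [set v in s], L v \subset S].
apply: (@le_trans _ _ (random_list_prob R k (fun L => has (fun S => inside S L) Ss))).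
  apply: random_list_prob_le => L _ /andP[_ pq].
  have [|S potS cS] := ex_superset_card (pot L [set v in s]) q; first by rewrite pq.
  apply/hasP; exists S; first by rewrite mem_enum inE cS.
  apply/forall_inP=> v vs; exact: fintype.subset_trans (sub_pot L _ v vs) potS.
apply: le_trans (random_list_prob_has R k Ss _) _.
have -> : \sum_(S <- Ss) random_list_prob R k (inside S)
    = 'C(#|C|, q)%:R * ('C(q, k)%:R / 'C(#|C|, k)%:R) ^+ size s.
  rewrite big_enum -card_draws mulr_natl -sumr_const; apply: eq_bigr => S.
  by rewrite inE => /eqP cS; rewrite random_list_prob_sub // cS cs.
have -> : q%:R ^+ (k * size s) / #|C|%:R ^+ (k * size s - q)
    = #|C|%:R ^+ q * ((q%:R / #|C|%:R) ^+ k) ^+ size s :> R.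
  rewrite -exprM exprMn exprVn mulrCA; congr (_ * _).
  rewrite -[in RHS](subnK qs) exprD invfM mulrCA divff ?mulr1 //.
  by rewrite expf_neq0 // gt_eqF.
have Ck0 : 0 < 'C(#|C|, k)%:R :> R by rewrite ltr0n bin_gt0.
apply: ler_pM => //.
  by rewrite -natrX ler_nat leq_bin_expn.
apply: lerXn2r; rewrite ?nnegrE ?exprn_ge0 ?divr_ge0 //.
rewrite expr_div_n ler_pdivrMr // mulrAC ler_pdivlMr ?exprn_gt0 //.
by rewrite -!natrX -!natrM ler_nat [leqRHS]mulnC leq_bin_exp.
Qed.

(** * Estimates *)

Lemma sum_growths_crowded (R : realType) (k : nat) {G : sgraph} {C : finType}
    (D q m : nat) : (k <= #|C|)%N -> (0 < #|C|)%N -> (q <= k * m.+1)%N ->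
  (max_degree G <= D)%N ->
  \sum_(s <- growths G m.+1)
      random_list_prob R k (fun L : list_assignment G C => crowded q s L)
    <= (m ^ m * q ^ (k * m.+1))%:R
         * (#|G|%:R * D%:R ^+ m / #|C|%:R ^+ (k * m.+1 - q)).
Proof.
move=> kC C0 qm GD.
pose b : R := q%:R ^+ (k * m.+1) / #|C|%:R ^+ (k * m.+1 - q).
have b0 : 0 <= b by rewrite divr_ge0 // exprn_ge0.
apply: (@le_trans _ _ ((size (growths G m.+1))%:R * b)).
  rewrite mulr_natl -[X in _ *+ X]count_predT -iter_addr_0 -big_const_seq.
  rewrite big_seq [leRHS]big_seq; apply: ler_sum => t /size_growth tm.
  by have := @random_list_prob_crowded R k G C q t kC C0; rewrite tm; apply.
rewrite /b [leLHS]mulrA [leRHS]mulrA ler_wpM2r ?invr_ge0 ?exprn_ge0 //.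
rewrite -!natrX -!natrM ler_nat.
apply: leq_trans (leq_mul (size_growths G m) (leqnn _)) _.
rewrite expnMn (mulnCA #|G|) mulnAC leq_mul // leq_mul //.
by case: (m) => // m'; rewrite leq_exp2r.
Qed.

(** The large factor in the denominator of the exponent of [n] in the bound on
    [Delta]. *)
Definition exponentD (k : nat) : nat := (k ^ 3 + 2 * k ^ 2 - k + 1)%N.

Lemma exponentD_ge (k : nat) : (0 < k)%N -> ((k.-1) ^ 2 + 1 <= exponentD k)%N.
Proof.
rewrite /exponentD; case: k => // k _; rewrite succnK !expnS expn0; nia.
Qed.

(** Here [N], [d], [s] stand for [n], [Delta], [sigma].  Split [k^2 D] as
    [k D + k D (k - 1)], bound the second part by [(A N^(k - 1))^(k - 1)], and
    absorb [N^(1 + (k - 1)^2)] into [N^D]: what remains is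
    [(N d^k)^D <= (e s^(k^2))^D]. *)
Lemma long_growth_estimate (R : realType) (k : nat) (A e N d s : R) :
  (0 < k)%N -> 1 <= N -> 0 <= d -> 0 <= e <= 1 -> 1 <= s -> 0 <= A ->
  d ^+ (k * exponentD k) <= A * N ^+ k.-1 ->
  N * d ^+ k <= e * s ^+ (k ^ 2) ->
  N * d ^+ (k ^ 2 * exponentD k)
    <= A ^+ k.-1 * e * s ^+ (k ^ 2 * exponentD k).
Proof.
move=> k0 N1 d0 /andP[e0 e1] s1 A0 dA Nd.
have N0 : 0 <= N by apply: le_trans N1.
have s0 : 0 <= s by apply: le_trans s1.
set D := exponentD k in dA *.
have eD : (k ^ 2 * D = k * D + k * D * k.-1)%N.
  by rewrite -{1}(prednK k0) expnS expn1 -mulnA -{2}(prednK k0) mulSn; nia.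
apply: (@le_trans _ _ (A ^+ k.-1 * (N * d ^+ k) ^+ D)); last first.
  rewrite -mulrA ler_wpM2l ?exprn_ge0 //.
  apply: (@le_trans _ _ ((e * s ^+ (k ^ 2)) ^+ D)).
    by apply: lerXn2r; rewrite ?nnegrE ?mulr_ge0 ?exprn_ge0.
  rewrite exprMn -exprM ler_wpM2r ?exprn_ge0 //.
  by rewrite ler_iXnr // /D /exponentD addn1.
have -> : (N * d ^+ k) ^+ D = N ^+ D * d ^+ (k * D) by rewrite exprMn exprM.
rewrite eD exprD [d ^+ (_ * k.-1)]exprM.
apply: (@le_trans _ _ (N * (d ^+ (k * D) * (A * N ^+ k.-1) ^+ k.-1))).
  rewrite ler_wpM2l // ler_wpM2l ?exprn_ge0 //.
  by apply: lerXn2r; rewrite ?nnegrE ?mulr_ge0 ?exprn_ge0.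
rewrite [leLHS](_ : _ = A ^+ k.-1 * (N ^+ (k.-1 * k.-1).+1 * d ^+ (k * D))); last first.
  by rewrite exprS exprMn [N ^+ (_ * _)]exprM; ring.
rewrite ler_wpM2l ?exprn_ge0 // ler_wpM2r ?exprn_ge0 //.
by rewrite ler_weXn2l // -addn1 mulnn exponentD_ge.
Qed.

(** For [k >= 2] [long_growth_estimate] bounds a power of [d / s], hence [d / s],
    and [s <= s^(k - 1)].  For [k = 1] the bound on [d] involves no [N], so
    [d] itself is bounded. *)
Lemma density_bounded (R : realType) (k : nat) (A e N d s : R) :
  (0 < k)%N -> 1 <= N -> 0 <= d -> 0 <= e <= 1 -> 1 <= s -> 0 <= A ->
  d ^+ (k * exponentD k) <= A * N ^+ k.-1 ->
  N * d ^+ k <= e * s ^+ (k ^ 2) ->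
  d <= (1 + A + A ^+ k.-1) * s ^+ k.-1.
Proof.
move=> k0 N1 d0 e01 s1 A0 dA Nd.
have s0 : 0 <= s by apply: le_trans s1.
have le1B : 1 <= 1 + A + A ^+ k.-1 by rewrite -addrA lerDl addr_ge0 ?exprn_ge0.
have D0 : (0 < exponentD k)%N by rewrite /exponentD addn1.
have [k1|k1] := eqVneq k 1%N.
  move: dA; rewrite k1 /= !expr0 !mulr1 mul1n => dA.
  have [d1|d1] := leP d 1; first by lra.
  have : d <= d ^+ exponentD 1 by rewrite ler_eXnr // ltW.
  by lra.
have := @long_growth_estimate R k A e N d s k0 N1 d0 e01 s1 A0 dA Nd.
set t := (k ^ 2 * _)%N => lt.
have t0 : (0 < t)%N by rewrite muln_gt0 expn_gt0 k0.
have {lt} : (d / s) ^+ t <= A ^+ k.-1.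
  have st : 0 < s ^+ t by rewrite exprn_gt0 // (lt_le_trans _ s1).
  rewrite expr_div_n ler_pdivrMr //; case/andP: e01 => e0 e1.
  have dt : 0 <= d ^+ t by rewrite exprn_ge0.
  have At : 0 <= A ^+ k.-1 * s ^+ t by rewrite mulr_ge0 ?exprn_ge0.
  by nra.
have sp : 0 < s by apply: lt_le_trans s1.
move=> ds; apply: (@le_trans _ _ ((1 + A + A ^+ k.-1) * s)).
  rewrite -ler_pdivrMr //; have [d1|d1] := leP (d / s) 1; first exact: le_trans le1B.
  have := ler_eXnr t0 (ltW d1); lra.
rewrite ler_wpM2l ?(le_trans ler01) // ler_eXnr //.
by case: (k) k0 k1 => // -[].
Qed.

Lemma exponent_split (k m : nat) : (0 < k)%N -> (k <= m)%N ->
  (k * m.+1 - m = k ^ 2 + k.-1 * (m - k))%N.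
Proof.
case: k => // j _ /subnKC <-; rewrite addKn succnK; set i := (m - _)%N.
(* Both sides equal [(j + 1)^2 + j i]. *)
rewrite mulSn addSn -addSn addnC; nia.
Qed.

(** The nonasymptotic form of the theorem: the constant depends on [k] and on
    the constant [A] of the degree bound only, and [e] measures how small
    [n Delta^k / sigma^(k^2)] is. *)
Lemma prob_uncolorable_le (R : realType) (k : nat) (A : R) :
  (0 < k)%N -> 0 <= A ->
  exists2 K : R, 0 <= K &
    forall (G : sgraph) (C : finType) (D : nat) (e : R),
      (0 < #|G|)%N -> (k <= #|C|)%N -> (max_degree G <= D)%N -> 0 <= e <= 1 ->
      D%:R ^+ (k * exponentD k) <= A * #|G|%:R ^+ k.-1 ->
      #|G|%:R * D%:R ^+ k <= e * #|C|%:R ^+ (k ^ 2) ->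
      random_list_prob R k (fun L : list_assignment G C => ~~ list_colorable L)
        <= K * e.
Proof.
move=> k0 A0; pose t := (k ^ 2 * exponentD k)%N.
pose c (m q : nat) : R := (m ^ m * q ^ (k * m.+1))%:R.
pose B : R := 1 + A + A ^+ k.-1.
have B0 : 0 <= B by rewrite !addr_ge0 ?exprn_ge0.
exists (c t (k.-1 * t.+1).+1 * A ^+ k.-1
        + \sum_(k.+1 <= m < t.+1) c m.-1 m.-1 * B ^+ (m.-1 - k)).
  by rewrite addr_ge0 ?sumr_ge0 // => *; rewrite mulr_ge0 ?exprn_ge0.
move=> G C D e G0 kC GD e01 DA De.
have C0 : (0 < #|C|)%N by apply: leq_trans kC.
have c0 : C by move/card_gt0P: C0 => /cid[].
have s1 : 1 <= #|C|%:R :> R by rewrite ler1n.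
have s0 : 0 < #|C|%:R :> R by rewrite ltr0n.
have N1 : 1 <= #|G|%:R :> R by rewrite ler1n.
have d0 : 0 <= D%:R :> R by [].
pose long (L : list_assignment G C) :=
  has (fun s => crowded (k.-1 * t.+1).+1 s L) (growths G t.+1).
pose short (L : list_assignment G C) :=
  has (fun m => has (fun s => crowded m.-1 s L) (growths G m)) (index_iota k.+1 t.+1).
apply: (@le_trans _ _ (random_list_prob R k (fun L => long L || short L))).
  by apply: random_list_prob_le => L Lk; exact: uncolorable_crowded.
apply: le_trans (random_list_probU R k long short) _.
rewrite mulrDl lerD //.
  apply: le_trans (random_list_prob_has R k _ _) _.
  have kt : (k * t.+1 = t.+1 + k.-1 * t.+1)%N by rewrite -mulSn prednK.
  have qt : ((k.-1 * t.+1).+1 <= k * t.+1)%N by rewrite kt -add1n leq_add2r.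
  have eqt : (k * t.+1 - (k.-1 * t.+1).+1 = t)%N.
    by rewrite kt addSn subSS addnK.
  apply: le_trans (sum_growths_crowded R k D _ t kC C0 qt GD) _.
  rewrite eqt -[leRHS]mulrA ler_wpM2l // ler_pdivrMr ?exprn_gt0 //.
  exact: long_growth_estimate.
apply: le_trans (random_list_prob_has R k _ _) _.
rewrite mulr_suml big_seq [leRHS]big_seq; apply: ler_sum => m.
rewrite mem_index_iota; case: m => // m /andP[km _]; rewrite succnK.
apply: le_trans (random_list_prob_has R k _ _) _.
have qm : (m <= k * m.+1)%N.
  exact: leq_trans (leqnSn m) (leq_pmull _ k0).
apply: le_trans (sum_growths_crowded R k D m m kC C0 qm GD) _.
rewrite -[leRHS]mulrA ler_wpM2l // ler_pdivrMr ?exprn_gt0 //.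
rewrite exponent_split //.
have -> : D%:R ^+ m = D%:R ^+ k * D%:R ^+ (m - k) :> R by rewrite -exprD subnKC.
rewrite exprD exprM [leLHS]mulrA.
rewrite [leRHS](_ : _ = e * #|C|%:R ^+ (k ^ 2) * (B * #|C|%:R ^+ k.-1) ^+ (m - k)).
  apply: ler_pM => //.
  apply: lerXn2r; rewrite ?nnegrE ?mulr_ge0 ?exprn_ge0 //.
  exact: density_bounded De.
by rewrite exprMn; ring.
Qed.

(** * Asymptotics *)

Local Open Scope classical_set_scope.
Local Open Scope ring_scope.

Lemma powR_inv_expn (R : realType) (x : R) (j : nat) : 0 <= x -> (0 < j)%N ->
  (x `^ (1 / j%:R)) ^+ j = x.
Proof.
move=> x0 j0; rewrite -powR_mulrn ?powR_ge0 // -powRrM.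
by rewrite div1r mulVf ?powRr1 // pnatr_eq0 -lt0n.
Qed.

Theorem theorem1p4 (R : realType) (k : nat) (k_gt0 : (0 < k)%N)
    (G : nat -> sgraph) (Delta sigma : nat -> nat)
    (card_G : forall n, #|G n| = n)
    (Delta_bound : forall n, (max_degree (G n) <= Delta n)%N)
    (k_le_sigma : forall n, (k <= sigma n)%N)
    (sigma_omega :
       (fun n : nat => n%:R `^ (1 / k%:R ^+ 2) * (Delta n)%:R `^ (1 / k%:R) : R)
         =o_\oo (fun n : nat => (sigma n)%:R : R))
    (Delta_bigO :
       (fun n : nat => (Delta n)%:R : R)
         =O_\oo (fun n : nat =>
           n%:R `^ ((k%:R - 1)
             / (k%:R * (k%:R ^+ 3 + 2 * k%:R ^+ 2 - k%:R + 1))) : R)) :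
  (fun n : nat => random_list_prob R k
     (fun L : list_assignment (G n) 'I_(sigma n) => list_colorable L))
    @ \oo --> (1 : R).
Proof.
have /eqOP[M0 [_ boundM0]] := Delta_bigO.
pose M : R := `|M0| + 1.
have M_ge0 : 0 <= M by rewrite addr_ge0.
have /boundM0 Delta_le : M0 < M by rewrite (le_lt_trans (ler_norm M0)) ?ltrDl.
have [K K0 boundK] := @prob_uncolorable_le R k (M ^+ (k * exponentD k)) k_gt0
  (exprn_ge0 _ M_ge0).
apply/cvgrPdist_le => eps eps0.
(* The [K + 1] avoids a division by zero when [K = 0]. *)
pose e : R := Num.min 1 (eps / (K + 1)).
have K1 : 0 < K + 1 by rewrite ltr_wpDl.
have e0 : 0 < e by rewrite lt_min ltr01 divr_gt0.
have e1 : e <= 1 by rewrite ge_min lexx.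
have /eqoP /(_ e e0) sigma_ge := sigma_omega.
near=> n.
have n0 : (0 < n)%N by near: n; exact: nbhs_infty_gt.
rewrite random_list_prob_compl ?card_ord // ger0_norm ?random_list_prob_ge0 //.
apply: (@le_trans _ _ (K * e)); last first.
  apply: (@le_trans _ _ ((K + 1) * e)); first by rewrite ler_wpM2r ?lerDl // ltW.
  by rewrite mulrC -ler_pdivlMr // ge_min lexx orbT.
apply: (boundK (G n) 'I_(sigma n) (Delta n)); rewrite ?card_G ?card_ord //.
- by rewrite e1 ltW.
- have : `|(Delta n)%:R : R| <= M * `|n%:R `^ ((k%:R - 1)
             / (k%:R * (k%:R ^+ 3 + 2 * k%:R ^+ 2 - k%:R + 1)))| by near: n.
  rewrite ger0_norm // ger0_norm ?powR_ge0 // => le_Delta.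
  set a := (_ / _) in le_Delta.
  have -> : n%:R ^+ k.-1 = (n%:R `^ a) ^+ (k * exponentD k) :> R.
    rewrite -!powR_mulrn ?powR_ge0 // -powRrM; congr (_ `^ _).
    have ED : k%:R ^+ 3 + 2 * k%:R ^+ 2 - k%:R + 1 = (exponentD k)%:R :> R.
      have le_k : (k <= k ^ 3 + 2 * k ^ 2)%N by rewrite !expnS expn0; nia.
      by rewrite /exponentD natrD natrB // natrD natrM !natrX.
    rewrite /a ED -natrM divfK; first by rewrite -subn1 natrB.
    by rewrite pnatr_eq0 muln_eq0 negb_or -lt0n k_gt0 /exponentD addn1.
  rewrite -exprMn; apply: lerXn2r; rewrite ?nnegrE ?mulr_ge0 ?powR_ge0 //.
- have : `|n%:R `^ (1 / k%:R ^+ 2) * (Delta n)%:R `^ (1 / k%:R) : R|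
           <= e * `|(sigma n)%:R : R| by near: n.
  rewrite ger0_norm ?mulr_ge0 ?powR_ge0 // ger0_norm // => le_sigma.
  have -> : n%:R * (Delta n)%:R ^+ k
      = (n%:R `^ (1 / k%:R ^+ 2) * (Delta n)%:R `^ (1 / k%:R)) ^+ (k ^ 2) :> R.
    have k2 : (0 < k ^ 2)%N by rewrite expn_gt0 k_gt0.
    have Dk := @powR_inv_expn R (Delta n)%:R k (ler0n R _) k_gt0.
    have nk := @powR_inv_expn R n%:R (k ^ 2) (ler0n R _) k2.
    by rewrite exprMn -[k%:R ^+ 2]natrX nk -mulnn exprM Dk.
  apply: (@le_trans _ _ ((e * (sigma n)%:R) ^+ (k ^ 2))).
    by apply: lerXn2r; rewrite ?nnegrE ?mulr_ge0 ?powR_ge0 ?(ltW e0).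
  rewrite exprMn ler_wpM2r ?exprn_ge0 // ler_iXnr ?(ltW e0) //.
  by rewrite expn_gt0 k_gt0.
Unshelve. all: by end_near.
Qed.
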